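(* Let $k\geq 2$. Every $k$-uniform local arc $\mathcal{S}$ in $\mathrm{PG}(2,q)$ has size $\left|\bigcup_{S\in\mathcal{S}}S\right|$ at most \[ k\left\lfloor\frac{4(k-1)+(3k-5)q+\sqrt{q\left(8(k-1)(q^2+k-2)-q(7k^2-10k-1)\right)}}{2k(k-1)}\right\rfloor. \]
   Context: $\mathrm{PG}(2,q)$ is the classical projective plane of order $q$. An arc is a set of points no three collinear. A local arc is a collection $\mathcal{S}$ of point sets such that for distinct $S_i,S_j\in\mathcal{S}$, $S_i\cap S_j=\emptyset$ and $S_i\cup S_j$ is an arc; it is $k$-uniform if all members have exactly $k$ points.
   Formalization: A local arc is also required to have every member be an arc; this matters only for one-member collections, where the pairwise condition is vacuous and the bound fails (q=2, k=7, the whole plane as single member: the radicand is negative and the bound undefined). *)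

(* Defs.v *)
From HB Require Import structures.
From mathcomp Require Import all_boot all_order all_algebra.
From mathcomp Require Import reals.
Set Implicit Arguments.
Unset Strict Implicit.
Unset Printing Implicit Defensive.
Import Order.TTheory GRing.Theory Num.Theory.
Local Open Scope ring_scope.
(* For the subType structure of {vspace vT} over matrices. *)
Import VectorInternalTheory.

HB.instance Definition _ (F : finFieldType) (vT : vectType F) :=
  [Countable of {vspace vT} by <:].
HB.instance Definition _ (F : finFieldType) (vT : vectType F) :=
  [Finite of {vspace vT} by <:].

(* PG(2, q) with q = #|F|: points and lines are the subspaces of F^3 of vector
   space dimension 1 and 2, and incidence is inclusion. *)
Record point (F : finFieldType) := Point {
  point_space :> {vspace 'rV[F]_3};
  _ : \dim point_space == 1%N }.

HB.instance Definition _ (F : finFieldType) := [isSub for @point_space F].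
HB.instance Definition _ (F : finFieldType) := [Finite of point F by <:].

Record line (F : finFieldType) := Line {
  line_space :> {vspace 'rV[F]_3};
  _ : \dim line_space == 2%N }.

HB.instance Definition _ (F : finFieldType) := [isSub for @line_space F].
HB.instance Definition _ (F : finFieldType) := [Finite of line F by <:].

Definition incident (F : finFieldType) (P : point F) (l : line F) : bool :=
  (point_space P <= line_space l)%VS.

Definition collinear (F : finFieldType) (P Q R : point F) : Prop :=
  exists l : line F, [/\ incident P l, incident Q l & incident R l].

Definition arc (F : finFieldType) (A : {set point F}) : Prop :=
  forall P Q R : point F, P \in A -> Q \in A -> R \in A ->
    P != Q -> Q != R -> P != R -> ~ collinear P Q R.

Definition pairwise_local_arc (F : finFieldType) (S : {set {set point F}}) :
    Prop :=
  forall A B : {set point F}, A \in S -> B \in S -> A != B ->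
    A :&: B = set0 /\ arc (A :|: B).

(* The condition on pairs says nothing about a collection with a single member,
   which could then be any point set (of any size, even the whole plane).
   Requiring the members to be arcs settles that case, and only that case: see
   local_arcE. *)
Definition local_arc (F : finFieldType) (S : {set {set point F}}) : Prop :=
  (forall A : {set point F}, A \in S -> arc A) /\ pairwise_local_arc S.

Definition uniform (F : finFieldType) (k : nat) (S : {set {set point F}}) :
    Prop :=
  forall A : {set point F}, A \in S -> #|A| = k.

Lemma local_arcE (F : finFieldType) (S : {set {set point F}}) :
  #|S| != 1%N -> local_arc S <-> pairwise_local_arc S.
Proof.
move=> S_neq1; split=> [[]//|pS]; split=> // A AS.
have [B BS nAB] : exists2 B, B \in S & A != B.
  have : (0 < #|S :\ A|)%N.
    by move: S_neq1; rewrite (cardsD1 A S) AS; case: #|_|.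
  by case/card_gt0P=> B; rewrite !inE eq_sym => /andP[nAB BS]; exists B.
have [_ arcAB] := pS A B AS BS nAB.
by move=> P Q R PA QA RA; apply: arcAB; rewrite inE ?PA ?QA ?RA.
Qed.

(* Main.v *)
Require Import Defs.
From HB Require Import structures.
From mathcomp Require Import all_boot all_order all_algebra.
From mathcomp Require Import reals.
From mathcomp Require Import finfield ring lra zify.
Set Implicit Arguments.
Unset Strict Implicit.
Unset Printing Implicit Defensive.
Import Order.TTheory GRing.Theory Num.Theory.
Local Open Scope ring_scope.

(** Let U be the union of S and N = #|U|. A line through two points of one
    member of S meets U in exactly those two points, so there are N (k - 1) / 2
    such internal secants. Give weight 1 to the other lines and 0 to these:
    double counting determines the weighted sums of 1, t and t ^ 2, where t is
    the number of points of U on a line, and the Cauchy-Schwarz inequality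
    between them is a quadratic inequality in N whose discriminant is the
    expression under the square root. *)

(** * Counting points, lines and incidences in the plane of order [q] *)

Section ProjectivePlane.
Variable F : finFieldType.
Implicit Types (P Q : point F) (l : line F) (V : {vspace 'rV[F]_3}).
Local Notation q := #|F|.

(** Double count of pairs of a point in [V] and a nonzero vector of that point: each point has
    [q.-1] such vectors, and each nonzero vector of [V] spans exactly one point. The product form
    avoids a division. *)
Lemma card_points_in_mul V :
  (#|[set P : point F | (P <= V)%VS]| * q.-1 = (q ^ \dim V).-1)%N.
Proof.
have nz (W : {vspace 'rV[F]_3}) : #|[set v in W | v != 0]| = (q ^ \dim W).-1.
  rewrite -(card_vspace W) [in RHS](cardD1 0) mem0v /= -sum1dep_card -sum1_card.
  by apply: eq_bigl => v; rewrite !inE andbC.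
have span_point (v : 'rV[F]_3) : v != 0 ->
    exists2 P : point F, point_space P = <[v]>%VS
                       & forall Q, (v \in point_space Q) = (Q == P).
  move=> v0; have dv : \dim <[v]> == 1%N by rewrite dim_vline v0.
  exists (Point dv) => // Q; apply/idP/eqP => [vQ|->]; last exact: memv_line.
  apply/val_inj/eqP; rewrite eq_sym /= eqEdim -memvE vQ (eqP dv).
  by case: (Q) => W /= /eqP->.
rewrite -(nz V) -sum_nat_const.
under eq_bigr => P _.
  have -> : q.-1 = #|[set v in point_space P | v != 0]|.
    by rewrite nz; case: (P) => W /= /eqP ->; rewrite expn1.
  rewrite -sum1dep_card big_mkcond /=; over.
rewrite exchange_big /= -sum1dep_card [RHS]big_mkcond /=.
apply: eq_bigr => v _; have [->|v0] := eqVneq v 0.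
  by rewrite andbF big1 // => P _; rewrite andbF.
have [P0 eP0 memP0] := span_point v v0; rewrite andbT.
under eq_bigr => P _ do rewrite andbT memP0.
rewrite -big_mkcondr /= [in RHS]memvE -eP0; case: ifP => sP0V.
  rewrite (big_pred1 P0) // => P /=; rewrite inE.
  by apply: andb_idl => /eqP ->.
by rewrite big1 // => P /andP[]; rewrite inE => sPV /eqP eP; rewrite -eP sPV in sP0V.
Qed.

Lemma card_field_gt1 : (1 < q)%N.
Proof. exact: finNzRing_gt1. Qed.

Lemma card_points_of_line l : #|[set P | incident P l]| = q.+1.
Proof.
have q1 : (0 < q.-1)%N by have := card_field_gt1; lia.
apply/eqP; rewrite -(eqn_pmul2r q1) card_points_in_mul.
have -> : \dim l = 2%N by case: l => W /= /eqP.
by case: q q1 => // n _; apply/eqP; lia.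
Qed.

Lemma card_points : #|{: point F}| = (q ^ 2 + q + 1)%N.
Proof.
have q1 : (0 < q.-1)%N by have := card_field_gt1; lia.
have allP : [set P : point F | (P <= fullv)%VS] = setT.
  by apply/setP => P; rewrite !inE subvf.
apply/eqP; rewrite -(eqn_pmul2r q1) -cardsT -allP card_points_in_mul.
have -> : \dim {:'rV[F]_3} = 3%N by rewrite dimvf /dim /=.
by case: q q1 => // n _; apply/eqP; lia.
Qed.

Lemma card_lines_through2 P Q :
  P != Q -> #|[set l | incident P l && incident Q l]| = 1%N.
Proof.
move=> nPQ.
have dP : \dim P = 1%N by case: (P) => W /= /eqP.
have dQ : \dim Q = 1%N by case: (Q) => W /= /eqP.
have dPQ : \dim (P + Q) == 2%N.
  rewrite dimv_disjoint_sum ?dP ?dQ //; apply/eqP.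
  rewrite -dimv_eq0; apply: contraNT nPQ => d0.
  (* A nonzero intersection would have dimension at least 1, hence equal both [P] and [Q]. *)
  have sub (W : {vspace 'rV[F]_3}) : \dim W = 1%N -> (P :&: Q <= W)%VS ->
      (P :&: Q)%VS = W.
    by move=> dW sW; apply/eqP; rewrite eqEdim sW dW lt0n.
  by rewrite -(inj_eq val_inj) /= -(sub _ dP (capvSl _ _)) {1}(sub _ dQ (capvSr _ _)).
apply/eqP/cards1P; exists (Line dPQ); apply/setP => l; rewrite !inE /incident.
rewrite -subv_add; apply/idP/eqP => [sl|->]; last exact: subvv.
apply/val_inj/eqP; rewrite eq_sym /= eqEdim sl (eqP dPQ).
by case: (l) => W /= /eqP->.
Qed.

(** Each of the [q ^ 2 + q] other points lies on one line through [P], and each such line carries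
    [q] of them. *)
Lemma card_lines_through P : #|[set l | incident P l]| = q.+1.
Proof.
have q1 := card_field_gt1.
have : (\sum_(Q | Q != P) #|[set l | incident P l && incident Q l]| = q ^ 2 + q)%N.
  rewrite (eq_bigr (fun=> 1%N)) => [|Q]; last by rewrite eq_sym => /card_lines_through2.
  rewrite sum1_card; have := cardC1 P; rewrite card_points => ->; lia.
under eq_bigr do rewrite -sum1dep_card big_mkcondr.
rewrite exchange_big /= (eq_bigr (fun=> q)) => [|l Pl].
  rewrite sum_nat_cond_const -mulnn -mulSnr => /eqP.
  by rewrite eqn_pmul2r ?(ltnW q1) // => /eqP.
rewrite -big_mkcondr sum1dep_card.
have := card_points_of_line l; rewrite (cardsD1 P) inE Pl => -[<-].
by apply: eq_card => Q; rewrite !inE.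
Qed.

Lemma card_lines : #|{: line F}| = (q ^ 2 + q + 1)%N.
Proof.
apply/eqP; rewrite -(eqn_pmul2r (ltn0Sn q)) -card_points -!sum_nat_const.
under eq_bigr => l _ do rewrite -(card_points_of_line l) -sum1dep_card big_mkcond.
rewrite exchange_big /=; apply/eqP/eq_bigr => P _.
by rewrite -big_mkcond sum1dep_card card_lines_through.
Qed.

Definition points_on (X : {set point F}) l := [set P in X | incident P l].

Lemma sum_card_points_on (X : {set point F}) :
  (\sum_l #|points_on X l| = #|X| * q.+1)%N.
Proof.
under eq_bigr do rewrite -sum1dep_card big_mkcondr.
rewrite exchange_big /= -sum_nat_const; apply: eq_bigr => P _.
by rewrite -big_mkcond sum1dep_card card_lines_through.
Qed.

(** The squares count ordered pairs in [X] with a common line: a diagonal pair lies on [q.+1] lines,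
    any other pair on one. *)
Lemma sum_card_points_on_sqr (X : {set point F}) :
  (\sum_l #|points_on X l| ^ 2 = #|X| * (#|X| + q))%N.
Proof.
have sqr l : (#|points_on X l| ^ 2 = \sum_(P in X) \sum_(Q in X)
    (if incident P l && incident Q l then 1 else 0))%N.
  rewrite -mulnn -sum1dep_card big_mkcondr big_distrl /=.
  apply: eq_bigr => P _; rewrite big_distrr; apply: eq_bigr => Q _ /=.
  by case: incident; case: incident.
under eq_bigr do rewrite sqr.
rewrite exchange_big /= -sum_nat_const; apply: eq_bigr => P PX.
rewrite exchange_big /= (bigD1 P) //= -big_mkcond sum1dep_card.
under eq_finset do rewrite andbb.
rewrite card_lines_through (eq_bigr (fun=> 1%N)) => [|Q /andP[_ nQP]].
  rewrite sum1dep_card (cardsD1 P X) PX /=.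
  have -> : [set Q in X | Q != P] = X :\ P by apply/setP => Q; rewrite !inE andbC.
  by rewrite add1n addSn addnC addSn.
by rewrite -big_mkcond sum1dep_card card_lines_through2 // eq_sym.
Qed.

End ProjectivePlane.

(** * Internal secants of a uniform local arc *)

Section LocalArc.
Variables (F : finFieldType) (S : {set {set point F}}) (k : nat).
Hypotheses (laS : local_arc S) (kS : uniform k S).
Local Notation U := (\bigcup_(A in S) A).

Lemma card_local_arc : #|U| = (#|S| * k)%N.
Proof.
have triv : trivIset S.
  by apply/trivIsetP => A B AS BS /(laS.2 A B AS BS)[AB _]; rewrite -setI_eq0 AB.
have := triv; rewrite /trivIset /cover => /eqP <-.
by rewrite -sum_nat_const; apply: eq_bigr => A /kS.
Qed.

(* Ordered pairs of distinct points on l lying in a common member of S. *)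
Definition secant_pairs (l : line F) :=
  (\sum_(A in S) #|points_on A l| * #|points_on A l|.-1)%N.

(** For each member, the sums of squares and of first powers differ by
    [k (k + q) - k (q + 1) = k (k - 1)]. *)
Lemma sum_secant_pairs : (\sum_l secant_pairs l = #|U| * k.-1)%N.
Proof.
rewrite exchange_big /= card_local_arc -mulnA -sum_nat_const.
apply: eq_bigr => A AS; have := sum_card_points_on_sqr A.
have -> : (\sum_l #|points_on A l| ^ 2 = \sum_l #|points_on A l| * #|points_on A l|.-1
    + \sum_l #|points_on A l|)%N.
  rewrite -big_split; apply: eq_bigr => l _ /=.
  by case: #|points_on A l| => //= c; rewrite -mulnSr mulnn.
rewrite sum_card_points_on (kS AS); case: (k) => [|j] /=; nia.
Qed.

(** If a member [A] has two points on [l], a third point of [l] in a member [B] would give three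
    collinear points of the arc [A :|: B]. So an internal secant carries one unordered pair, that is
    two ordered ones. *)
Lemma secant_pairsP l :
  secant_pairs l = 0%N \/ secant_pairs l = 2 /\ #|points_on U l| = 2.
Proof.
have [le1|] := boolP [forall (A | A \in S), #|points_on A l| <= 1]%N.
  left; apply: big1 => A AS; move/forall_inP: le1 => /(_ _ AS).
  by case: #|_| => [|[]].
rewrite negb_forall_in => /exists_inP[A AS]; rewrite -ltnNge => /card_gt1P.
move=> [P [Q [PAl QAl nPQ]]]; right.
move: PAl QAl; rewrite !inE => /andP[PA Pl] /andP[QA Ql].
have onPQ B T : B \in S -> T \in B -> incident T l -> T = P \/ T = Q.
  move=> BS TB Tl; have [->|nTP] := eqVneq T P; first by left.
  right; apply/eqP; apply/negPn/negP => nTQ.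
  have arcAB : Defs.arc (A :|: B).
    (* The third point may lie in [A] itself; then [A] being an arc is what applies. *)
    have [<-|nAB] := eqVneq A B; first by rewrite setUid; apply: laS.1.
    by case: (laS.2 A B AS BS nAB).
  apply: (arcAB P Q T); rewrite ?inE ?PA ?QA ?TB ?orbT // 1?eq_sym //.
  by exists l.
(* The set [X] is left general to serve both for [U] and for [A]. *)
have PQl (X : {set point F}) : P \in X -> Q \in X -> X \subset U -> points_on X l = [set P; Q].
  move=> PX QX /subsetP sXU; apply/setP => T; rewrite !inE.
  apply/andP/orP => [[/sXU /bigcupP[B BS TB] Tl]|[/eqP->|/eqP->]] //.
  by case: (onPQ B T BS TB Tl) => ->; [left|right].
have PU : P \in U by apply/bigcupP; exists A.
have QU : Q \in U by apply/bigcupP; exists A.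
split; last by rewrite PQl // cards2 nPQ.
rewrite /secant_pairs (bigD1 A) //= PQl //; last exact: bigcup_sup.
rewrite cards2 nPQ big1 // => B /andP[BS nBA].
have [AB0 _] := laS.2 B A BS AS nBA.
suff -> : points_on B l = set0 by rewrite cards0.
apply/setP => T; rewrite !inE; apply/negP => /andP[TB Tl].
have TA : T \in A by case: (onPQ B T BS TB Tl) => ->.
by have := in_set0 T; rewrite -AB0 inE TB TA.
Qed.

End LocalArc.

(** * Cauchy-Schwarz and the quadratic inequality *)

Lemma weighted_cauchy_schwarz (R : realFieldType) (I : finType) (w t : I -> R) :
  (forall i, 0 <= w i) ->
  (\sum_i w i * t i) ^+ 2 <= (\sum_i w i) * (\sum_i w i * t i ^+ 2).
Proof.
move=> w0.
(* By Lagrange's identity this double sum is twice the difference of the two sides. *)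
have : 0 <= \sum_i \sum_j w i * w j * (t i - t j) ^+ 2.
  by apply: sumr_ge0 => i _; apply: sumr_ge0 => j _;
    apply: mulr_ge0 (sqr_ge0 _); apply: mulr_ge0.
have -> : \sum_i \sum_j w i * w j * (t i - t j) ^+ 2 =
    ((\sum_i w i * t i ^+ 2) * (\sum_i w i) + (\sum_i w i) * (\sum_i w i * t i ^+ 2))
    - 2 * ((\sum_i w i * t i) * (\sum_i w i * t i)).
  rewrite !big_distrlr /= -big_split mulr_sumr -sumrB; apply: eq_bigr => i _ /=.
  rewrite -big_split mulr_sumr -sumrB; apply: eq_bigr => j _ /=; ring.
rewrite expr2; lra.
Qed.

Theorem theorem2p3 (R : realType) (F : finFieldType) (q : nat)
    (hq : #|F| = q) (k : nat) (hk : (2 <= k)%N)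
    (S : {set {set point F}}) (hS : local_arc S) (hSk : uniform k S) :
  (#|\bigcup_(A in S) A|%:Z <=
   k%:Z * Num.floor
     ((4 * (k%:R - 1) + (3 * k%:R - 5) * q%:R
       + Num.sqrt (q%:R *
           (8 * (k%:R - 1) * (q%:R ^+ 2 + k%:R - 2)
            - q%:R * (7 * k%:R ^+ 2 - 10 * k%:R - 1))))
      / (2 * k%:R * (k%:R - 1)) : R))%R.
Proof.
rewrite (card_local_arc hS hSk) mulnC PoszM ler_pM2l ?ltz_nat ?(ltnW hk) //.
set D := q%:R * _; set n := #|S|.
have k2 : 2 <= k%:R :> R by rewrite ler_nat.
have q0 : 0 <= q%:R :> R by [].
rewrite floor_ge_int ler_pdivlMr; last by rewrite !mulr_gt0 //; lra.
(* The empty collection is treated apart because [N] is cancelled below; there the numerator is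
   nonnegative since [2 <= k]. *)
have [n0|n_gt0] := posnP n.
  have := sqrtr_ge0 D; rewrite n0 mul0r; nra.
pose N : R := (n * k)%:R.
have NE : N = n%:R * k%:R by rewrite /N natrM.
have N0 : 0 < N by rewrite ltr0n muln_gt0 n_gt0 (ltnW hk).
pose s l : R := (secant_pairs S l)%:R.
pose t l : R := #|points_on (\bigcup_(A in S) A) l|%:R.
(* As [s l] is 0 or 2, this is 0 on internal secants and 1 on the other lines. *)
pose w l : R := 1 - s l / 2.
have stP l : s l = 0 \/ s l = 2 /\ t l = 2.
  by rewrite /s /t; case: (secant_pairsP hS l) => [->|[-> ->]]; [left|right].
have sum_s : \sum_l s l = N * (k%:R - 1).
  rewrite -natr_sum (sum_secant_pairs hS hSk) (card_local_arc hS hSk) natrM.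
  by rewrite -subn1 natrB // (ltnW hk).
have sum_w : \sum_l w l = q%:R ^+ 2 + q%:R + 1 - N * (k%:R - 1) / 2.
  rewrite sumrB -mulr_suml sum_s sumr_const card_lines hq.
  by rewrite !natrD natrX.
(* Since [t l = 2] whenever [s l] is nonzero, [s l * t l / 2 = s l]; likewise
   [s l * t l ^+ 2 / 2 = 2 * s l] for the second moment. *)
have sum_wt : \sum_l w l * t l = N * (q%:R + 1) - N * (k%:R - 1).
  rewrite -sum_s natr1 -hq -natrM -(card_local_arc hS hSk) -sum_card_points_on.
  rewrite natr_sum -sumrB; apply: eq_bigr => l _; rewrite /w -/(t l).
  by case: (stP l) => [->|[-> ->]]; lra.
have sum_wt2 : \sum_l w l * t l ^+ 2 = N * (N + q%:R) - 2 * (N * (k%:R - 1)).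
  rewrite -sum_s -natrD -hq -natrM -(card_local_arc hS hSk).
  rewrite -sum_card_points_on_sqr natr_sum mulr_sumr -sumrB.
  apply: eq_bigr => l _; rewrite /w natrX -/(t l).
  by case: (stP l) => [->|[-> ->]]; lra.
have := @weighted_cauchy_schwarz R _ w t.
rewrite sum_w sum_wt sum_wt2 => CS.
have {}CS : N * (q%:R + 2 - k%:R) ^+ 2 <=
    (q%:R ^+ 2 + q%:R + 1 - N * (k%:R - 1) / 2) * (N + q%:R - 2 * (k%:R - 1)).
  rewrite -(ler_pM2l N0).
  have w0 l : 0 <= w l by rewrite /w; case: (stP l) => [->|[-> _]]; lra.
  by have := CS w0; lra.
(* Multiplying [CS] by [8 * (k%:R - 1)] completes the square: the left side squared is at most
   [D]. *)
have : 2 * (k%:R - 1) * N - (4 * (k%:R - 1) + (3 * k%:R - 5) * q%:R) <= Num.sqrt D.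
  apply: le_trans (ler_norm _) _; rewrite -sqrtr_sqr; apply: ler_wsqrtr.
  have k1 : 0 <= 8 * (k%:R - 1) :> R by lra.
  by have := ler_wpM2l k1 CS; rewrite /D; lra.
rewrite NE -pmulrn; lra.
Qed.
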